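(* Let $f:\mathbb{R}^d\to\mathbb{R}$ be twice continuously differentiable. Then the function $L:\mathbb{R}^d\times(0,\infty)\to[0,\infty)$ defined by $L(x,R)=\max_{y\in B(x,R)}\|\nabla^2 f(y)\|$ is a local first-order smoothness oracle (LFSO) for $f$.
   Context: Here $\|\cdot\|$ is the Euclidean norm on vectors and the induced operator 2-norm on matrices, and $B(x,R)=\{y\in\mathbb{R}^d:\|y-x\|\le R\}$. For a continuously differentiable $f:\mathbb{R}^d\to\mathbb{R}$, a function $L:\mathbb{R}^d\times(0,\infty)\to[0,\infty)$ is a local first-order smoothness oracle (LFSO) for $f$ if (i) for all $x\in\mathbb{R}^d$, all $R>0$ and all $y\in B(x,R)$, $|f(y)-f(x)-\nabla f(x)^T(y-x)|\le \frac{L(x,R)}{2}\|y-x\|^2$; and (ii) $L$ is non-decreasing in its second argument $R$. *)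

(* Defs.v *)
From HB Require Import structures.
From mathcomp Require Import all_boot all_order all_algebra.
From mathcomp Require Import all_classical all_reals all_analysis.

Set Implicit Arguments.
Unset Strict Implicit.
Unset Printing Implicit Defensive.

Import Order.TTheory GRing.Theory Num.Theory.
Import numFieldNormedType.Exports.

Local Open Scope classical_set_scope.
Local Open Scope ring_scope.

(* R^d is 'rV[R]_d. Its library norm `|v| is the sup norm, which induces the
   usual topology and hence the usual notions of continuity and
   differentiability; the Euclidean norm is [enorm]. *)

Definition dotv (R : realType) (d : nat) (u v : 'rV[R]_d) : R :=
  \sum_(i < d) u ord0 i * v ord0 i.

Definition enorm (R : realType) (d : nat) (v : 'rV[R]_d) : R :=
  Num.sqrt (dotv v v).

Definition eball (R : realType) (d : nat) (x : 'rV[R]_d) (r : R)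
    : set 'rV[R]_d :=
  [set y | enorm (y - x) <= r].

(* Vectors being rows, v *m A^T is the (transposed) image A v^T of v by A. *)
Definition opnorm (R : realType) (d : nat) (A : 'M[R]_d) : R :=
  sup [set enorm (v *m A^T) | v in [set v : 'rV[R]_d | enorm v <= 1]].

Definition gradient (R : realType) (d : nat) (f : 'rV[R]_d -> R)
    (x : 'rV[R]_d) : 'rV[R]_d :=
  \row_(i < d) 'D_(delta_mx ord0 i) f x.

Definition hessian (R : realType) (d : nat) (f : 'rV[R]_d -> R)
    (x : 'rV[R]_d) : 'M[R]_d :=
  \matrix_(i < d, j < d)
    'D_(delta_mx ord0 i) (fun y => 'D_(delta_mx ord0 j) f y) x.

Definition C1 (R : realType) (d : nat) (f : 'rV[R]_d -> R) : Prop :=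
  (forall x, differentiable f x) /\ continuous (gradient f).

Definition C2 (R : realType) (d : nat) (f : 'rV[R]_d -> R) : Prop :=
  [/\ C1 f,
      forall x, differentiable (gradient f) x
    & continuous (hessian f)].

(* The domain R^d x (0, oo) and the codomain [0, oo) of L are rendered by the
   guards 0 < r and by [lfso_ge0]; values of L at r <= 0 are irrelevant. *)
Record LFSO (R : realType) (d : nat) (f : 'rV[R]_d -> R)
    (L : 'rV[R]_d -> R -> R) : Prop := {
  lfso_C1 : C1 f ;
  lfso_ge0 : forall (x : 'rV[R]_d) (r : R), 0 < r -> 0 <= L x r ;
  lfso_bound : forall (x : 'rV[R]_d) (r : R), 0 < r ->
    forall y : 'rV[R]_d, eball x r y ->
      `|f y - f x - dotv (gradient f x) (y - x)|
        <= L x r / 2 * enorm (y - x) ^+ 2 ;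
  lfso_mono : forall (x : 'rV[R]_d) (r s : R),
    0 < r -> r <= s -> L x r <= L x s }.

Definition is_max (R : realType) (A : set R) (m : R) : Prop :=
  A m /\ ubound A m.

Definition hessian_norms (R : realType) (d : nat) (f : 'rV[R]_d -> R)
    (x : 'rV[R]_d) (r : R) : set R :=
  [set opnorm (hessian f y) | y in eball x r].

(* A supremum, with junk value 0 on unbounded sets; it is a maximum exactly
   when [is_max (hessian_norms f x r) (max_hessian_norm f x r)]. *)
Definition max_hessian_norm (R : realType) (d : nat) (f : 'rV[R]_d -> R)
    (x : 'rV[R]_d) (r : R) : R :=
  sup (hessian_norms f x r).

(* Main.v *)
(* Along the segment p(t) = x + t v with v = y - x, the function f o p has
   second derivative v H v^T with H the Hessian at p(t), which by Cauchy-Schwarz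
   is at most ||H|| ||v||^2; two applications of the mean value theorem turn
   this bound into the quadratic remainder estimate. The maximum over the ball is
   attained since the operator norm is Lipschitz and the ball is compact. *)
Require Import Defs.
From mathcomp Require Import all_boot all_order all_algebra.
From mathcomp Require Import all_classical all_reals all_analysis.
From mathcomp Require Import ring lra.

Set Implicit Arguments.
Unset Strict Implicit.
Unset Printing Implicit Defensive.

Import Order.TTheory GRing.Theory Num.Theory.
Import numFieldNormedType.Exports.

Local Open Scope classical_set_scope.
Local Open Scope ring_scope.

(** * Euclidean inner product and norm *)

Lemma dotvC (R : realType) (d : nat) (u v : 'rV[R]_d) : dotv u v = dotv v u.
Proof. by apply: eq_bigr => i _; rewrite mulrC. Qed.

Lemma dotv_mulmx (R : realType) (d : nat) (u v : 'rV[R]_d) :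
  dotv u v = (u *m v^T) ord0 ord0.
Proof. by rewrite mxE; apply: eq_bigr => i _; rewrite mxE. Qed.

Lemma dotvDl (R : realType) (d : nat) (u v w : 'rV[R]_d) :
  dotv (u + v) w = dotv u w + dotv v w.
Proof. by rewrite !dotv_mulmx mulmxDl mxE. Qed.

Lemma dotvZl (R : realType) (d : nat) (a : R) (u v : 'rV[R]_d) :
  dotv (a *: u) v = a * dotv u v.
Proof. by rewrite !dotv_mulmx -scalemxAl mxE. Qed.

Lemma dotvDr (R : realType) (d : nat) (u v w : 'rV[R]_d) :
  dotv u (v + w) = dotv u v + dotv u w.
Proof. by rewrite dotvC dotvDl !(dotvC u). Qed.

Lemma dotvZr (R : realType) (d : nat) (a : R) (u v : 'rV[R]_d) :
  dotv u (a *: v) = a * dotv u v.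
Proof. by rewrite dotvC dotvZl dotvC. Qed.

Lemma dotv_ge0 (R : realType) (d : nat) (v : 'rV[R]_d) : 0 <= dotv v v.
Proof. by apply: sumr_ge0 => i _; rewrite -expr2 sqr_ge0. Qed.

Lemma dotv_eq0 (R : realType) (d : nat) (v : 'rV[R]_d) : dotv v v = 0 -> v = 0.
Proof.
move=> /eqP; rewrite psumr_eq0; last by move=> i _; rewrite -expr2 sqr_ge0.
move=> /allP v0; apply/rowP => i; rewrite mxE.
by have := v0 i (mem_index_enum _); rewrite /= -expr2 sqrf_eq0 => /eqP.
Qed.

Lemma enorm_ge0 (R : realType) (d : nat) (v : 'rV[R]_d) : 0 <= enorm v.
Proof. exact: sqrtr_ge0. Qed.

Lemma sqr_enorm (R : realType) (d : nat) (v : 'rV[R]_d) :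
  enorm v ^+ 2 = dotv v v.
Proof. by rewrite sqr_sqrtr ?dotv_ge0. Qed.

Lemma enorm0 (R : realType) (d : nat) : enorm (0 : 'rV[R]_d) = 0.
Proof. by rewrite /enorm dotv_mulmx mul0mx mxE sqrtr0. Qed.

Lemma enorm_eq0 (R : realType) (d : nat) (v : 'rV[R]_d) : enorm v = 0 -> v = 0.
Proof. by move=> v0; apply: dotv_eq0; rewrite -sqr_enorm v0 expr0n. Qed.

Lemma enormZ (R : realType) (d : nat) (a : R) (v : 'rV[R]_d) :
  enorm (a *: v) = `|a| * enorm v.
Proof.
by rewrite /enorm dotvZl dotvZr mulrA -expr2 sqrtrM ?sqr_ge0 // sqrtr_sqr.
Qed.

Lemma dotv_cauchy_schwarz (R : realType) (d : nat) (u v : 'rV[R]_d) :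
  `|dotv u v| <= enorm u * enorm v.
Proof.
rewrite -ler_sqr ?nnegrE ?mulr_ge0 ?enorm_ge0 // exprMn !sqr_enorm.
rewrite real_normK ?num_real //.
have [v0|vn0] := eqVneq (dotv v v) 0.
  rewrite (dotv_eq0 v0) dotv_mulmx trmx0 mulmx0 mxE expr0n.
  by rewrite mulr_ge0 ?dotv_ge0.
have v_gt0 : 0 < dotv v v by rewrite lt0r vn0 dotv_ge0.
(* The squared length of this vector expands to [dotv v v] times the Cauchy-Schwarz gap, and
   [dotv v v] is positive here. *)
have := dotv_ge0 (dotv v v *: u + (- dotv u v) *: v).
rewrite !(dotvDl, dotvDr, dotvZl, dotvZr) (dotvC v u) => ineq.
rewrite -subr_ge0 -(pmulr_rge0 _ v_gt0); apply: le_trans ineq _.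
by rewrite le_eqVlt; apply/orP; left; apply/eqP; ring.
Qed.

Lemma enormD (R : realType) (d : nat) (u v : 'rV[R]_d) :
  enorm (u + v) <= enorm u + enorm v.
Proof.
rewrite -ler_sqr ?nnegrE ?addr_ge0 ?enorm_ge0 // sqr_enorm.
have := le_trans (ler_norm _) (dotv_cauchy_schwarz u v).
rewrite dotvDl !dotvDr (dotvC v u) sqrrD !sqr_enorm.
lra.
Qed.

(** * Comparison with the sup norm, and compactness of Euclidean balls *)

Lemma mx_coord_le_norm (R : realType) (m n : nat) (A : 'M[R]_(m, n)) i j :
  `|A i j| <= `|A|.
Proof.
rewrite [leRHS]/Num.Def.normr/= mx_normrE.
exact: (le_bigmax _ (fun k : 'I_m * 'I_n => `|A k.1 k.2|) (i, j)).
Qed.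

Lemma mx_norm_le (R : realType) (m n : nat) (A : 'M[R]_(m, n)) (c : R) :
  0 <= c -> (forall i j, `|A i j| <= c) -> `|A| <= c.
Proof.
move=> c0 Ac; rewrite [leLHS]/Num.Def.normr/= mx_normrE.
by apply: bigmax_le => // -[i j] _; exact: Ac.
Qed.

Lemma coord_le_enorm (R : realType) (d : nat) (v : 'rV[R]_d) i :
  `|v ord0 i| <= enorm v.
Proof.
rewrite -sqrtr_sqr ler_wsqrtr // /dotv (bigD1 i) //= -expr2 lerDl.
by apply: sumr_ge0 => j _; rewrite -expr2 sqr_ge0.
Qed.

Lemma norm_le_enorm (R : realType) (d : nat) (v : 'rV[R]_d) : `|v| <= enorm v.
Proof.
by apply: mx_norm_le (enorm_ge0 v) _ => i j; rewrite (ord1 i) coord_le_enorm.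
Qed.

Lemma enorm_le_norm (R : realType) (d : nat) (v : 'rV[R]_d) :
  enorm v <= d%:R * `|v|.
Proof.
rewrite -ler_sqr ?nnegrE ?mulr_ge0 ?enorm_ge0 // sqr_enorm exprMn.
(* Bounding [d] squares yields the factor [d], then relaxed to the square of [d] so that the final
   constant is [d] rather than its square root. *)
apply: (@le_trans _ _ (d%:R * `|v| ^+ 2)).
  rewrite -[d in d%:R]card_ord mulr_natl -sumr_const.
  by apply: ler_sum => i _; rewrite -expr2 -(ger0_norm (sqr_ge0 _)) normrX
    lerXn2r ?nnegrE ?mx_coord_le_norm.
apply: ler_wpM2r; first exact: sqr_ge0.
by rewrite -natrX ler_nat; case: d {v} => // d; rewrite leq_pmull.
Qed.

(** Exchanging [x] and [y] turns the one-sided bound into a bound on the absolute value. This form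
    suits [enorm] and [opnorm], where the triangle inequality bounds a signed difference. *)
Lemma lipschitz_continuous (R : realType) (V : normedModType R) (g : V -> R)
    (C : R) :
  (forall x y, g x - g y <= C * `|x - y|) -> continuous g.
Proof.
move=> gC x; apply/cvgrPdist_le => /= e e0.
(* [C] may be zero or negative, so a positive constant above it is used as divisor. *)
have M0 : 0 < `|C| + 1 by rewrite ltr_wpDl.
near=> y.
have le1 : `|g x - g y| <= (`|C| + 1) * `|x - y|.
  rewrite ler_norml lerNl opprB; apply/andP; split.
    rewrite (le_trans (gC y x)) // distrC ler_wpM2r //.
    by rewrite (le_trans (ler_norm C)) // lerDl.
  rewrite (le_trans (gC x y)) // ler_wpM2r //.
  by rewrite (le_trans (ler_norm C)) // lerDl.
apply: le_trans le1 _; rewrite -ler_pdivlMl // mulrC.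
near: y; apply: cvgr_dist_le; first exact: cvg_id.
by rewrite divr_gt0.
Unshelve. all: by end_near. Qed.

Lemma enorm_dist_continuous (R : realType) (d : nat) (x : 'rV[R]_d) :
  continuous (fun y : 'rV[R]_d => enorm (y - x)).
Proof.
apply: (@lipschitz_continuous _ _ _ d%:R) => y z.
apply: le_trans (enorm_le_norm _); rewrite lerBlDr.
by have := enormD (y - z) (z - x); rewrite subrKA.
Qed.

(** Heine-Borel: the ball is bounded in the sup norm by [r] plus the norm of [x], and closed as the
    preimage of a closed half-line under the distance to [x]. *)
Lemma eball_compact (R : realType) (d : nat) (x : 'rV[R]_d) (r : R) :
  compact (eball x r).
Proof.
apply: bounded_closed_compact.
  exists (r + `|x|); split; first exact: num_real.
  move=> M rM y /= xyr; apply: ltW; apply: le_lt_trans rM.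
  rewrite -[y](subrK x) (le_trans (ler_normD _ _)) // lerD2r.
  exact: le_trans (norm_le_enorm _) xyr.
refine (@preimage_closed _ _ (fun y : 'rV[R]_d => enorm (y - x))
  [set t | t <= r] _ (@closed_le _ r)) => y _.
exact: enorm_dist_continuous.
Qed.

(** * The operator norm and its maximum over a ball *)

Lemma enorm_mulmx_le (R : realType) (d : nat) (A : 'M[R]_d) (v : 'rV[R]_d) :
  enorm (v *m A^T) <= d%:R * d%:R * `|A| * enorm v.
Proof.
(* One factor [d] comes from passing to the sup norm, the other from the [d] products summed in each
   coordinate. *)
apply: le_trans (enorm_le_norm _) _; rewrite -!mulrA ler_wpM2l //.
apply: mx_norm_le => [|i j]; first by rewrite !mulr_ge0 ?enorm_ge0.
rewrite (ord1 i) mxE (le_trans (ler_norm_sum _ _ _)) //.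
rewrite -[d in d%:R]card_ord mulr_natl -sumr_const.
apply: ler_sum => k _; rewrite normrM mxE mulrC.
by rewrite ler_pM ?mx_coord_le_norm ?coord_le_enorm.
Qed.

Lemma opnorm_le (R : realType) (d : nat) (A : 'M[R]_d) (c : R) :
  (forall v : 'rV[R]_d, enorm v <= 1 -> enorm (v *m A^T) <= c) -> opnorm A <= c.
Proof.
move=> Ac; apply: ge_sup => [|_ [v v1 <-]]; last exact: Ac.
by exists (enorm (0 *m A^T)); exists 0; rewrite //= enorm0.
Qed.

(** Guarantees that the [sup] in [opnorm] is a genuine supremum and not the default value 0. *)
Lemma opnorm_has_ubound (R : realType) (d : nat) (A : 'M[R]_d) :
  has_ubound [set enorm (v *m A^T) | v in [set v : 'rV[R]_d | enorm v <= 1]].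
Proof.
exists (d%:R * d%:R * `|A|) => _ [v v1 <-].
by apply: le_trans (enorm_mulmx_le A v) _; rewrite ler_piMr ?mulr_ge0.
Qed.

Lemma opnorm_ge0 (R : realType) (d : nat) (A : 'M[R]_d) : 0 <= opnorm A.
Proof.
apply: (ub_le_sup (opnorm_has_ubound A)).
by exists 0; rewrite /= ?mul0mx enorm0.
Qed.

(** By homogeneity: a nonzero [v] is rescaled to unit length. *)
Lemma enorm_mulmx_opnorm (R : realType) (d : nat) (A : 'M[R]_d) (v : 'rV[R]_d) :
  enorm (v *m A^T) <= opnorm A * enorm v.
Proof.
have [/enorm_eq0 ->|v_neq0] := eqVneq (enorm v) 0.
  by rewrite mul0mx enorm0 mulr0.
have v_gt0 : 0 < enorm v by rewrite lt0r v_neq0 enorm_ge0.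
rewrite -ler_pdivrMr // mulrC.
apply: (ub_le_sup (opnorm_has_ubound A)); exists ((enorm v)^-1 *: v).
  by rewrite /= enormZ ger0_norm ?invr_ge0 ?enorm_ge0 // mulVf.
by rewrite -scalemxAl enormZ ger0_norm ?invr_ge0 ?enorm_ge0.
Qed.

(** Splitting [A] as [(A - B) + B] gives a Lipschitz bound with respect to the sup norm of
    matrices. *)
Lemma opnorm_continuous (R : realType) (d : nat) :
  continuous (@opnorm R d : 'M[R]_d -> R).
Proof.
apply: (@lipschitz_continuous _ _ _ (d%:R * d%:R)) => A B.
rewrite lerBlDr; apply: opnorm_le => v v1.
have -> : v *m A^T = v *m (A - B)^T + v *m B^T.
  by rewrite -mulmxDr -linearD /= subrK.
apply: le_trans (enormD _ _) _; apply: lerD.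
  by apply: le_trans (enorm_mulmx_le _ _) _; rewrite ler_piMr ?mulr_ge0.
by apply: le_trans (enorm_mulmx_opnorm _ _) _; rewrite ler_piMr ?opnorm_ge0.
Qed.

Lemma hessian_norms_max (R : realType) (d : nat) (f : 'rV[R]_d -> R) x r :
  continuous (hessian f) -> 0 < r ->
  is_max (hessian_norms f x r) (max_hessian_norm f x r).
Proof.
move=> Hf r0.
have x_ball : eball x r x by rewrite /eball /= subrr enorm0 ltW.
have [|y] := @EVT_max_rV R d (fun y => opnorm (hessian f y)) (eball x r)
  (ex_intro _ x x_ball) (@eball_compact R d x r).
  apply: continuous_subspaceT => y.
  by apply: continuous_comp; [exact: Hf | exact: opnorm_continuous].
rewrite inE => y_ball y_max.
(* The value at the maximiser is an upper bound lying in the set, hence equals its [sup]. *)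
have ub : ubound (hessian_norms f x r) (opnorm (hessian f y)).
  by move=> _ [z z_ball <-]; apply: y_max; rewrite inE.
suff -> : max_hessian_norm f x r = opnorm (hessian f y).
  by split => //; exists y.
apply/eqP; rewrite eq_le; apply/andP; split.
  by apply: ge_sup ub; exists (opnorm (hessian f y)); exists y.
by apply: ub_le_sup; [exists (opnorm (hessian f y)) | exists y].
Qed.

(** * Directional derivatives, gradient and Hessian *)

Lemma is_derive_line (R : realType) (V W : normedModType R) (g : V -> W)
    (x v : V) (t : R) :
  derivable g (x + t *: v) v ->
  is_derive t 1 (fun s : R => g (x + s *: v)) ('D_v g (x + t *: v)).
Proof.
move=> gv.
pose gl (s : R) := g (x + s *: v).
(* Both derivatives are limits of the same difference quotient, so no chain rule is invoked. *)
have E : (fun h : R => h^-1 *: ((gl \o shift t) (h *: 1) - gl t)) =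
         (fun h : R => h^-1 *: ((g \o shift (x + t *: v)) (h *: v)
            - g (x + t *: v))).
  apply/funext => h /=; rewrite /gl; congr (_ *: (g _ - _)).
  by rewrite [h *: 1]mulr1 scalerDl addrCA.
by split; rewrite /derivable /derive E.
Qed.

Lemma derive_row (R : realType) (d : nat) (W : normedModType R)
    (g : 'rV[R]_d -> W) (x v : 'rV[R]_d) :
  differentiable g x ->
  'D_v g x = \sum_(i < d) v ord0 i *: 'D_(delta_mx ord0 i) g x.
Proof.
move=> dg; rewrite deriveE // {1}(row_sum_delta v) linear_sum.
by apply: eq_bigr => i _; rewrite linearZ deriveE.
Qed.

Lemma derive_gradient (R : realType) (d : nat) (f : 'rV[R]_d -> R)
    (x v : 'rV[R]_d) :
  differentiable f x -> 'D_v f x = dotv (gradient f x) v.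
Proof.
by move=> df; rewrite derive_row //; apply: eq_bigr => i _; rewrite mxE mulrC.
Qed.

(** Row [i] of [hessian f x] is the derivative of the gradient along the [i]-th basis vector, so [v]
    multiplies from the left without a transpose. *)
Lemma derive_hessian (R : realType) (d : nat) (f : 'rV[R]_d -> R)
    (x v : 'rV[R]_d) :
  differentiable (gradient f) x -> 'D_v (gradient f) x = v *m hessian f x.
Proof.
move=> df; rewrite derive_row // mulmx_sum_row; apply: eq_bigr => i _.
congr (_ *: _); rewrite derive_mx; last exact: diff_derivable.
apply/rowP => j; rewrite mxE [RHS]mxE [RHS]mxE.
have -> : (fun y => gradient f y 0 j) = 'D_(delta_mx ord0 j) f.
  by apply/funext => y; rewrite mxE.
by [].
Qed.

Lemma is_derive_dotv (R : realType) (d : nat) (V : normedModType R)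
    (g : V -> 'rV[R]_d) (dg v : 'rV[R]_d) (x w : V) :
  is_derive x w g dg -> is_derive x w (fun y => dotv (g y) v) (dotv dg v).
Proof.
move=> [gx <-].
have gi i : is_derive x w (fun y => g y ord0 i * v ord0 i)
    (('D_w g x) ord0 i * v ord0 i).
  have gix : derivable (fun y => g y ord0 i) x w.
    exact: ((@derivable_mxP R V 1 d g x w).1 gx ord0 i).
  rewrite (derive_mx gx) mxE.
  have -> : (fun y => g y ord0 i * v ord0 i) =
      v ord0 i *: (fun y => g y ord0 i).
    by apply/funext => y; rewrite mulrC.
  by rewrite mulrC; apply: is_deriveZ; apply: derivableP.
have -> : (fun y => dotv (g y) v) =
    \sum_(i < d) (fun y => g y ord0 i * v ord0 i).
  by apply/funext => y; rewrite fct_sumE.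
exact: is_derive_sum.
Qed.

(** * Second-order Taylor estimate on the unit interval *)

Lemma is_derive_continuous (R : realType) (g dg : R -> R) :
  (forall t : R, is_derive t 1 g (dg t)) -> continuous g.
Proof.
move=> gd t; apply: differentiable_continuous; apply/derivable1_diffP.
exact: ex_derive.
Qed.

Lemma taylor2_le (R : realType) (g g1 g2 : R -> R) (M : R) :
  (forall t : R, is_derive t 1 g (g1 t)) ->
  (forall t : R, is_derive t 1 g1 (g2 t)) ->
  (forall t : R, 0 <= t <= 1 -> g2 t <= M) ->
  g 1 - g 0 - g1 0 <= M / 2.
Proof.
move=> dg dg1 g2M.
(* The claim reads [k 1 - k 0 <= 0]. The mean value theorem turns this difference into the
   derivative of [k] at some [c]; applied again to [g1] on [[0, c]], it gives [(g2 e - M) * c]. *)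
pose k (t : R) := g t - g1 0 * t - M / 2 * t ^+ 2.
have dk (t : R) : is_derive t 1 k (g1 t - g1 0 - M * t).
  have -> : k = g - g1 0 *: id - (M / 2) *: (id ^+ 2 : R -> R) by [].
  have -> : g1 t - g1 0 - M * t =
      g1 t - g1 0 *: 1 - (M / 2) *: ((2%:R * t ^+ 1) *: 1).
    by rewrite /GRing.scale /=; field.
  exact: is_deriveB.
have [c c01] := MVT_segment ler01 (fun t _ => dk t)
  (continuous_subspaceT (is_derive_continuous dk)).
rewrite in_itv /= in c01; have /andP[c0 c1] := c01.
(* Since [c] may be 0, the closed-segment form, which allows a degenerate interval, is used. *)
have [e e0c] := MVT_segment c0 (fun t _ => dg1 t)
  (continuous_subspaceT (is_derive_continuous dg1)).
rewrite in_itv /= in e0c; have /andP[e0 ec] := e0c.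
rewrite /k subr0 => g1c kc.
have : g2 e * c <= M * c by rewrite ler_wpM2r // g2M // e0 (le_trans ec).
lra.
Qed.

Lemma taylor2_abs_le (R : realType) (g g1 g2 : R -> R) (M : R) :
  (forall t : R, is_derive t 1 g (g1 t)) ->
  (forall t : R, is_derive t 1 g1 (g2 t)) ->
  (forall t : R, 0 <= t <= 1 -> `|g2 t| <= M) ->
  `|g 1 - g 0 - g1 0| <= M / 2.
Proof.
move=> dg dg1 g2M; rewrite ler_norml lerNl; apply/andP; split; last first.
  by apply: (taylor2_le dg dg1) => t /g2M; rewrite ler_norml => /andP[].
(* The lower bound is the upper bound for the negated functions. *)
have := @taylor2_le R (- g) (- g1) (- g2) M (fun t => is_deriveN (dg t))
  (fun t => is_deriveN (dg1 t)).
rewrite !opprD; apply => t /g2M.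
by rewrite ler_norml lerNl => /andP[].
Qed.

Theorem lemma2p2 (R : realType) (d : nat) (f : 'rV[R]_d -> R) :
  C2 f ->
  (forall (x : 'rV[R]_d) (r : R), 0 < r ->
     is_max (hessian_norms f x r) (max_hessian_norm f x r)) /\
  LFSO f (max_hessian_norm f).
Proof.
move=> [Cf dgrad Hf].
have max x r : 0 < r -> _ := @hessian_norms_max R d f x r Hf.
split=> //; split=> // [x r r0|x r r0 y xy|x r s r0 rs].
- by have [[y _ <-] _] := max x r r0; exact: opnorm_ge0.
- have [_ maxP] := max x r r0; set v := y - x.
  pose p (t : R) := x + t *: v.
  have dg (t : R) : is_derive t 1 (f \o p) (dotv (gradient f (p t)) v).
    rewrite -derive_gradient; last exact: Cf.1.
    by apply: is_derive_line; apply: diff_derivable; exact: Cf.1.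
  have dg1 (t : R) : is_derive t 1 (fun s : R => dotv (gradient f (p s)) v)
      (dotv (v *m hessian f (p t)) v).
    rewrite -(derive_hessian v (dgrad (p t))).
    apply: (@is_derive_dotv _ _ _ (fun s : R => gradient f (p s))).
    apply: (@is_derive_line _ _ _ (gradient f)).
    exact: diff_derivable.
  (* The endpoints are [p 0 = x] and [p 1 = y]; the bound [M] will be the maximum times
     [enorm v ^+ 2]. *)
  have := taylor2_abs_le dg dg1; rewrite /p /= scale1r scale0r addr0 subrKC.
  rewrite mulrAC; apply => t /andP[t0 t1].
  (* Moves the Hessian to the second argument, where it appears as [v *m (hessian _ _)^T], the form
     used by [opnorm]. *)
  rewrite dotv_mulmx -mulmxA -[hessian _ _]trmxK -trmx_mul -dotv_mulmx.
  apply: le_trans (dotv_cauchy_schwarz _ _) _.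
  rewrite mulrC expr2 mulrA ler_wpM2r ?enorm_ge0 //.
  apply: le_trans (enorm_mulmx_opnorm _ _) _; rewrite ler_wpM2r ?enorm_ge0 //.
  (* The segment stays in the ball, since [t *: v] is no longer than [v] for [t] in [[0, 1]]. *)
  apply: maxP; exists (x + t *: v) => //.
  rewrite /eball /= addrC addKr enormZ ger0_norm // (le_trans _ xy) //.
  by rewrite ler_piMl ?enorm_ge0.
(* The maximum over the smaller ball is attained at a point that also lies in the larger one. *)
- have [[y xy <-] _] := max x r r0.
  have [_] := max x s (lt_le_trans r0 rs); apply.
  by exists y => //; exact: le_trans xy rs.
Qed.
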